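(* Let $S$ be a countable set, and let $\mathcal{H}$ be a Hilbert space over $\mathbb{C}$ (or $\mathbb{R}$). Then the following two conditions are equivalent: (i) There is a tight frame $\{\mathbf{v}(s) \mid s\in S\}\subset\mathcal{H}$ with frame constant $c=1$, i.e. a family of vectors indexed by $S$ such that $\|f\|^2=\sum_{s\in S}|\langle \mathbf{v}(s)\mid f\rangle|^2$ for all $f\in\mathcal{H}$. (ii) $\mathcal{H}$ is isometrically embedded (as a closed subspace) in $\ell^2(S)$, i.e. there is a linear map $V\colon\mathcal{H}\to\ell^2(S)$ with $\|Vf\|=\|f\|$ for all $f\in\mathcal{H}$.
   Context: ''Countable'' means finite or infinite countable. $\ell^2(S)$ is the Hilbert space of square-summable scalar functions on $S$, over the same scalar field as $\mathcal{H}$. Inner products $\langle\cdot\mid\cdot\rangle$ are conjugate-linear in the first variable and linear in the second. For $c>0$, a family $(\mathbf{v}(s))_{s\in S}$ in $\mathcal{H}$ is a tight frame with frame constant $c$ if $\|f\|^2=c\sum_{s\in S}|\langle\mathbf{v}(s)\mid f\rangle|^2$ for all $f\in\mathcal{H}$. *)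

(* Defs.v *)
From HB Require Import structures.
From mathcomp Require Import all_boot all_order all_algebra.
From mathcomp Require Import complex.
From mathcomp Require Import all_classical all_reals all_analysis.
From mathcomp Require Import ring.

Set Implicit Arguments.
Unset Strict Implicit.
Unset Printing Implicit Defensive.

Import Order.TTheory GRing.Theory Num.Theory.
Import numFieldNormedType.Exports.

Local Open Scope classical_set_scope.
Local Open Scope ring_scope.

Variant scalar_kind := real_scalars | complex_scalars.

Definition scalars (R : realType) (k : scalar_kind) : numFieldType :=
  match k with real_scalars => R | complex_scalars => R[i] end.

Definition scalar_conj (R : realType) (k : scalar_kind) :
    scalars R k -> scalars R k :=
  match k with real_scalars => idfun | complex_scalars => @conjc R end.

(* In MathComp the norm `|x| of x : scalars R k, and also the norm of a vector,
   is an element of scalars R k.  The two functions below go back and forth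
   between R and scalars R k: modulus x is `|x| seen in R, and in particular
   modulus `|f| is the norm of a vector f as an element of R. *)
Definition modulus (R : realType) (k : scalar_kind) : scalars R k -> R :=
  match k with real_scalars => Num.norm | complex_scalars => @Normc.normc R end.

Definition of_real (R : realType) (k : scalar_kind) : R -> scalars R k :=
  match k with
  | real_scalars => idfun
  | complex_scalars => fun x => Complex x 0
  end.

Section scalars_theory.
Context {R : realType} {k : scalar_kind}.
Implicit Types (x y : scalars R k) (a b : R).

Lemma modulusE x : `|x| = of_real k (modulus x).
Proof. by case: k x => [x//|[a b]]. Qed.

Lemma modulus_ge0 x : 0 <= modulus x.
Proof. by case: k x => [x|[a b]] /=; rewrite ?sqrtr_ge0. Qed.

Lemma modulusM x y : modulus (x * y) = modulus x * modulus y.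
Proof. by case: k x y => [x y|x y] /=; rewrite ?normrM ?Normc.normcM. Qed.

Lemma modulus0 : modulus (0 : scalars R k) = 0.
Proof. by case: k => /=; [exact: normr0|exact: Normc.normc0]. Qed.

Lemma modulus0_eq0 x : modulus x = 0 -> x = 0.
Proof.
by case: k x => [x /normr0_eq0//|x] /=; exact: Normc.eq0_normc.
Qed.

Lemma le_modulusD x y : modulus (x + y) <= modulus x + modulus y.
Proof. by case: k x y => [|] x y /=; rewrite ?ler_normD// le_normcD. Qed.

Lemma of_realD a b : of_real k (a + b) = of_real k a + of_real k b.
Proof. by case: k => //=; rewrite /GRing.add/= addr0. Qed.

Lemma of_realM a b : of_real k (a * b) = of_real k a * of_real k b.
Proof. by case: k => //=; rewrite /GRing.mul/= !(mulr0, mul0r) subr0 addr0. Qed.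

Lemma ler_of_real a b : (of_real k a <= of_real k b) = (a <= b).
Proof. by case: k => //=; rewrite lecR. Qed.

Lemma of_real_eq0 a : of_real k a = 0 -> a = 0.
Proof. by case: k => //= -[]. Qed.

End scalars_theory.

(* The library form dot is linear in its first argument and conjugate-linear in
   its second one. *)
HB.mixin Record NormedModule_isHilbert (R : realType) (k : scalar_kind) H
    & CompleteNormedModule (scalars R k) H := {
  hilbert_dot : {dot H for @scalar_conj R k};
  hilbert_sqr_norm : forall f : H, `|f| ^+ 2 = hilbert_dot f f
}.

#[short(type="hilbertType")]
HB.structure Definition Hilbert (R : realType) (k : scalar_kind) :=
  {H of CompleteNormedModule (scalars R k) H & NormedModule_isHilbert R k H}.

(* The inner product <u | v>, conjugate-linear in u and linear in v. *)
Definition inner (R : realType) (k : scalar_kind) (H : hilbertType R k)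
  (u v : H) : scalars R k := hilbert_dot v u.

(* A sum of nonnegative terms is the supremum of its finite partial sums, with
   value +oo if it diverges. *)
Definition sum_sqr (R : realType) (k : scalar_kind) (S : choiceType)
    (u : S -> scalars R k) : \bar R :=
  \esum_(s in [set: S]) (modulus (u s) ^+ 2)%:E.

Definition tight_frame (R : realType) (k : scalar_kind) (H : hilbertType R k)
    (S : choiceType) (v : S -> H) (c : R) : Prop :=
  0 < c /\
  forall f : H,
    ((modulus `|f| ^+ 2)%:E = c%:E * sum_sqr (fun s => inner (v s) f))%E.

Section sum_sqr_theory.
Context {R : realType} {k : scalar_kind} {S : choiceType}.
Local Notation K := (scalars R k).
Implicit Types (u v : S -> K).

Lemma sum_sqr_ge0 u : (0 <= sum_sqr u)%E.
Proof. by apply: esum_ge0 => s _; rewrite lee_fin sqr_ge0. Qed.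

Lemma le_sum_sqr u s : ((modulus (u s) ^+ 2)%:E <= sum_sqr u)%E.
Proof.
apply: esum_ge; exists [set s]; first by split => //; exact: finite_set1.
by rewrite fsbig_set1.
Qed.

Lemma esumZl (r : R) (a : S -> \bar R) : 0 <= r -> (forall s, 0 <= a s)%E ->
  (\esum_(s in [set: S]) (r%:E * a s) = r%:E * \esum_(s in [set: S]) a s)%E.
Proof.
move=> r0 a0; rewrite /esum -ereal_supZl//; last first.
  by apply/set0P; exists (\sum_(s \in set0) a s)%E; exists set0.
congr ereal_sup; rewrite image_comp; apply: eq_imagel => A [finA _] /=.
by rewrite ge0_mule_fsumr.
Qed.

Lemma sum_sqrZ (a : K) u :
  (sum_sqr (a *: u)%R = (modulus a ^+ 2)%:E * sum_sqr u)%E.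
Proof.
rewrite /sum_sqr -esumZl ?sqr_ge0//; last by move=> s; rewrite lee_fin sqr_ge0.
by apply: eq_esum => s _; rewrite -EFinM -exprMn -modulusM.
Qed.

(* Minkowski's inequality, in the form needed for the triangle inequality. *)
Lemma sum_sqrD u v (a b : R) : 0 <= a -> 0 <= b ->
  (sum_sqr u <= (a ^+ 2)%:E -> sum_sqr v <= (b ^+ 2)%:E ->
   sum_sqr (u + v)%R <= ((a + b) ^+ 2)%:E)%E.
Proof.
rewrite le_eqVlt => /predU1P[<- b0|a0].
  rewrite expr0n/= add0r => u0 vb; apply: le_trans vb; apply: le_esum => s _.
  have us0 : u s = 0.
    apply/modulus0_eq0/eqP; rewrite -sqrf_eq0 eq_le sqr_ge0 andbT -lee_fin.
    exact: le_trans (le_sum_sqr u s) u0.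
  by rewrite -[(u + v) s]/(u s + v s) us0 add0r.
rewrite le_eqVlt => /predU1P[<-|b0].
  rewrite expr0n/= addr0 => ua v0; apply: le_trans ua; apply: le_esum => s _.
  have vs0 : v s = 0.
    apply/modulus0_eq0/eqP; rewrite -sqrf_eq0 eq_le sqr_ge0 andbT -lee_fin.
    exact: le_trans (le_sum_sqr v s) v0.
  by rewrite -[(u + v) s]/(u s + v s) vs0 addr0.
move=> ua vb; pose c := (a + b) / a; pose d := (a + b) / b.
have c0 : 0 < c by rewrite divr_gt0 ?addr_gt0.
have d0 : 0 < d by rewrite divr_gt0 ?addr_gt0.
have H s : modulus ((u + v) s) ^+ 2 <=
    c * modulus (u s) ^+ 2 + d * modulus (v s) ^+ 2.
  rewrite -[(u + v) s]/(u s + v s).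
  set x := modulus (u s); set y := modulus (v s).
  apply: (@le_trans _ _ ((x + y) ^+ 2)).
    by rewrite ler_sqr ?nnegrE ?addr_ge0 ?modulus_ge0 ?le_modulusD.
  have -> : c * x ^+ 2 + d * y ^+ 2 =
      (x + y) ^+ 2 + (b * x - a * y) ^+ 2 / (a * b).
    by rewrite /c /d; field; rewrite !gt_eqF.
  by rewrite lerDl divr_ge0 ?sqr_ge0 ?mulr_ge0 ?ltW.
apply: (@le_trans _ _ (\esum_(s in [set: S])
    (c%:E * (modulus (u s) ^+ 2)%:E + d%:E * (modulus (v s) ^+ 2)%:E))%E).
  by apply: le_esum => s _; rewrite -!EFinM -EFinD lee_fin.
rewrite esumD; last 2 first.
  by move=> s _; rewrite mule_ge0 ?lee_fin ?sqr_ge0 ?ltW.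
  by move=> s _; rewrite mule_ge0 ?lee_fin ?sqr_ge0 ?ltW.
rewrite (esumZl (ltW c0)) ?(esumZl (ltW d0)); last 2 first.
  by move=> s; rewrite lee_fin sqr_ge0.
  by move=> s; rewrite lee_fin sqr_ge0.
have -> : (a + b) ^+ 2 = c * a ^+ 2 + d * b ^+ 2.
  by rewrite /c /d; field; rewrite !gt_eqF.
by rewrite EFinD (EFinM c) (EFinM d); apply: leeD; rewrite lee_pmul2l// lte_fin.
Qed.

End sum_sqr_theory.

Section ell2.
Context (R : realType) (k : scalar_kind) (S : choiceType).
Local Notation K := (scalars R k).

Definition sqr_summable : {pred S -> K} := mem [set u | (sum_sqr u < +oo)%E].

Record ell2 := Ell2 { ell2_fun :> S -> K; _ : ell2_fun \in sqr_summable }.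

HB.instance Definition _ := [isSub for ell2_fun].
HB.instance Definition _ := [Choice of ell2 by <:].

Lemma sqr_summableP (u : S -> K) :
  u \in sqr_summable ->
  exists2 a : R, 0 <= a & sum_sqr u = (a ^+ 2)%:E.
Proof.
rewrite inE/= => uoo; exists (Num.sqrt (fine (sum_sqr u))); first exact: sqrtr_ge0.
rewrite sqr_sqrtr ?fine_ge0 ?sum_sqr_ge0// fineK// ge0_fin_numE//.
exact: sum_sqr_ge0.
Qed.

Lemma sqr_summable_submod_closed : submod_closed sqr_summable.
Proof.
split=> [|a u v /sqr_summableP[b b0 ub] /sqr_summableP[c c0 vc]]; rewrite inE/=.
  rewrite /sum_sqr esum1// => s _; by rewrite modulus0 expr0n.
have : (sum_sqr (a *: u + v)%R <= ((modulus a * b + c) ^+ 2)%:E)%E.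
  apply: sum_sqrD; rewrite ?mulr_ge0 ?modulus_ge0//; last by rewrite vc.
  by rewrite sum_sqrZ ub -EFinM exprMn.
by move=> /le_lt_trans; apply; rewrite ltry.
Qed.

HB.instance Definition _ :=
  GRing.isSubmodClosed.Build K (S -> K) sqr_summable sqr_summable_submod_closed.
HB.instance Definition _ := [SubChoice_isSubLmodule of ell2 by <:].

Implicit Types u v : ell2.

Let nm u : R := Num.sqrt (fine (sum_sqr u)).

Definition ell2_norm u : K := of_real k (Num.sqrt (fine (sum_sqr u))).

Let nm_sqr u : sum_sqr u = (nm u ^+ 2)%:E.
Proof.
case/sqr_summableP: (valP u) => a a0 ua.
by rewrite /nm ua/= sqrtr_sqr ger0_norm.
Qed.

Lemma ell2_ler_normD u v : ell2_norm (u + v) <= ell2_norm u + ell2_norm v.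
Proof.
rewrite /ell2_norm -of_realD ler_of_real -/(nm (u + v)) -/(nm u) -/(nm v).
rewrite -ler_sqr ?nnegrE ?addr_ge0 ?sqrtr_ge0// -lee_fin -nm_sqr.
by apply: sum_sqrD; rewrite ?sqrtr_ge0 ?nm_sqr.
Qed.

Lemma ell2_normrZ (a : K) u : ell2_norm (a *: u) = `|a| * ell2_norm u.
Proof.
rewrite /ell2_norm modulusE -of_realM -/(nm u); congr of_real.
have /= -> := sum_sqrZ a u; rewrite nm_sqr -EFinM -exprMn/= sqrtr_sqr.
by rewrite ger0_norm ?mulr_ge0 ?modulus_ge0 ?sqrtr_ge0.
Qed.

Lemma ell2_norm0_eq0 u : ell2_norm u = 0 -> u = 0.
Proof.
move=> /of_real_eq0; rewrite -/(nm u) => u0; apply/val_inj/funext => s /=.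
apply/modulus0_eq0/eqP; rewrite -sqrf_eq0 eq_le sqr_ge0 andbT -lee_fin.
by rewrite (le_trans (le_sum_sqr u s))// nm_sqr u0 expr0n.
Qed.

HB.instance Definition _ := Lmodule_isNormed.Build K ell2
  ell2_ler_normD ell2_normrZ ell2_norm0_eq0.

Lemma ell2_normE u : `|u| = of_real k (Num.sqrt (fine (sum_sqr u))).
Proof. by []. Qed.

End ell2.

Lemma isometry_closed_range (R : realType) (k : scalar_kind) (S : choiceType)
    (H : hilbertType R k) (V : {linear H -> ell2 R k S}) :
  (forall f : H, `|V f| = `|f|) -> closed (range V).
Proof.
move=> Viso y ycl.
pose F : set_system H := filter_from (nbhs y) (fun U => V @^-1` U).
have FF : ProperFilter F.
  apply: filter_from_proper; last first.
    by move=> U /ycl[_ [[x _ <-] Ux]]; exists x.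
  apply: filter_from_filter; first by exists setT; exact: filterT.
  by move=> U U' yU yU'; exists (U `&` U') => //; exact: filterI.
have Fball e : 0 < e -> F [set x | `|y - V x| < e].
  move=> e0; exists (ball y e); first exact: nbhsx_ballx.
  by move=> x; rewrite -ball_normE.
have /cauchy_cvg/cvg_ex[/= x Fx] : cauchy F.
  apply/cauchy_ballP => e e0.
  have e2 : 0 < e / 2 by rewrite divr_gt0.
  exists ([set x | `|y - V x| < e / 2], [set x | `|y - V x| < e / 2]).
    by split; exact: Fball.
  move=> [a b] /= [ya yb]; rewrite -ball_normE/= -Viso raddfB.
  rewrite -(subrKA y) (le_lt_trans (ler_normD _ _))// (splitr e) ltrD//.
  by rewrite distrC.
exists x => //; apply/eqP; rewrite -subr_eq0 -normr_le0.
apply/ler_addgt0Pl => e e0; rewrite addr0.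
have e2 : 0 < e / 2 by rewrite divr_gt0.
have Fxe : F [set a | `|x - a| < e / 2].
  by apply: Fx; have := @nbhsx_ballx _ _ x _ e2; rewrite -ball_normE.
have [a [xa ya]] := filter_ex (filterI Fxe (Fball _ e2)).
rewrite -(subrKA (V a)) (le_trans (ler_normD _ _))// (splitr e) ltW// ltrD//.
  by rewrite -raddfB Viso.
by rewrite distrC.
Qed.

(* Main.v *)
Require Import Defs.
From HB Require Import structures.
From mathcomp Require Import all_boot all_order all_algebra.
From mathcomp Require Import complex.
From mathcomp Require Import all_classical all_reals all_analysis.
From mathcomp Require Import ring lra.

Import Order.TTheory GRing.Theory Num.Theory.
Import numFieldNormedType.Exports.

Local Open Scope classical_set_scope.
Local Open Scope ring_scope.

Set Implicit Arguments.
Unset Strict Implicit.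
Unset Printing Implicit Defensive.

(** A family v and a linear map V into l^2(S) determine each other by
    (V f)(s) = <v(s) | f>: the s-th coordinate of V f is the s-th frame
    coefficient of f.  With this dictionary, the tight frame identity with
    constant 1 says that the coefficients of f are square-summable with sum
    of squares |f|^2, which is exactly that V is well defined and isometric.

    The analysis map of a frame is linear because the inner product is linear
    in its second variable (tight_frame_isometry).  Conversely, an isometry V
    yields for each s the coordinate functional f |-> (V f)(s), which is
    contractive since |u(s)| <= |u| in l^2(S), hence continuous, hence equal
    to <v(s) | _> for some v(s) by the Riesz representation theorem
    (isometry_tight_frame).

    The Riesz theorem (riesz_representation) is proved for both scalar fields
    at once.  If phi <> 0, the hyperplane phi = 1 is closed, nonempty and
    convex, so it has a point z of minimal norm (min_norm_point, by the
    parallelogram law and completeness); minimality makes z orthogonal to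
    ker phi (min_norm_orthogonal), and then phi f = <z | f> / <z | z> because
    f - phi(f) z lies in ker phi. *)

(** * Real numbers among the scalars, and conjugation *)

Section scalars_complements.
Context {R : realType} {k : scalar_kind}.
Implicit Types (x y : scalars R k) (a b : R).

Lemma of_real_inj : injective (@of_real R k).
Proof. by case: k => // a b []. Qed.

Lemma ltr_of_real a b : (of_real k a < of_real k b) = (a < b).
Proof. by rewrite !lt_neqAle ler_of_real (inj_eq of_real_inj). Qed.

Lemma of_real0 : of_real k 0 = 0 :> scalars R k.
Proof. by case: k. Qed.

Lemma of_real_half : of_real k 2^-1 = 2^-1 :> scalars R k.
Proof.
apply: (@mulIf _ 2) => //; rewrite mulVf// mulr_natr mulr2n -of_realD.
have -> : 2^-1 + 2^-1 = 1 :> R by lra.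
by case: k.
Qed.

(** Radii of balls are positive elements of the scalar field; over the complex
    numbers too, positivity forces them to be real. *)
Lemma gt0_of_real x : 0 < x -> exists2 a, 0 < a & x = of_real k a.
Proof.
move=> x0; have xE : x = of_real k (modulus x).
  by rewrite -modulusE gtr0_norm.
exists (modulus x) => //; rewrite -ltr_of_real -xE.
by rewrite of_real0.
Qed.

Lemma scalar_conj0 : scalar_conj (0 : scalars R k) = 0.
Proof. by case: k => //; exact: conjc0. Qed.

Lemma scalar_conjM x y : scalar_conj (x * y) = scalar_conj x * scalar_conj y.
Proof. by case: k x y => // x y; exact: rmorphM (@conjc R) x y. Qed.

Lemma scalar_conjV x : scalar_conj x^-1 = (scalar_conj x)^-1.
Proof. by case: k x => // x; exact: fmorphV (@conjc R) x. Qed.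

Lemma mul_scalar_conj x : x * scalar_conj x = `|x| ^+ 2.
Proof.
case: k x => [|] x /=; first by rewrite -normrX ger0_norm ?sqr_ge0 ?expr2.
by rewrite sqr_normc.
Qed.

End scalars_complements.

(** * Inner products and the Riesz representation theorem *)

Section inner_theory.
Context {R : realType} {k : scalar_kind} {H : hilbertType R k}.
Implicit Types (f g h : H) (a : scalars R k).

Lemma innerDr f g h : inner f (g + h) = inner f g + inner f h.
Proof.
have B := @zmod_morphisml_subproof _ _ _ _ _ _ (@hilbert_dot R k H) f.
have := B (g + h) h; rewrite addrK /inner => ->.
by rewrite subrK.
Qed.

Lemma innerZr a f g : inner f (a *: g) = a * inner f g.
Proof. exact: (@linearl_subproof _ _ _ _ _ _ (@hilbert_dot R k H) f a g). Qed.

Lemma innerC f g : inner f g = scalar_conj (inner g f).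
Proof.
rewrite /inner; have := @hermitian_subproof _ _ _ _ (@hilbert_dot R k H) g f.
by rewrite expr0 mul1r.
Qed.

Lemma innerBr f g h : inner f (g - h) = inner f g - inner f h.
Proof. by rewrite -scaleN1r innerDr innerZr mulN1r. Qed.

Lemma innerDl f g h : inner (f + g) h = inner f h + inner g h.
Proof.
have B := @zmod_morphismr_subproof _ _ _ _ _ _ (@hilbert_dot R k H) h.
have := B (f + g) g; rewrite addrK /inner => ->.
by rewrite subrK.
Qed.

Lemma innerZl a f g : inner (a *: f) g = scalar_conj a * inner f g.
Proof. by rewrite innerC innerZr scalar_conjM -innerC. Qed.

Lemma innerBl f g h : inner (f - g) h = inner f h - inner g h.
Proof.
have B := @zmod_morphismr_subproof _ _ _ _ _ _ (@hilbert_dot R k H) h.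
exact: B.
Qed.

Lemma inner_norm f : inner f f = `|f| ^+ 2.
Proof. by rewrite hilbert_sqr_norm. Qed.

Lemma parallelogram f g :
  `|f + g| ^+ 2 + `|f - g| ^+ 2 = 2 * (`|f| ^+ 2 + `|g| ^+ 2).
Proof.
rewrite -!inner_norm !(innerBl, innerBr, innerDl, innerDr); ring.
Qed.

(** Moving from f along the line of h brings the norm down to that of
    f - t h with t = <h | f> / <h | h>, whose square is
    |f|^2 - |<h | f>|^2 / |h|^2; minimality at f kills the last term. *)
Lemma min_norm_orthogonal f h :
  (forall t : scalars R k, `|f| <= `|f - t *: h|) -> inner h f = 0.
Proof.
have [->|h0] := eqVneq h 0.
  by rewrite -(scale0r (0 : H)) innerZl scalar_conj0 mul0r.
move=> fmin; pose q := inner h h.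
have q0 : 0 < q by rewrite /q inner_norm exprn_gt0 ?normr_gt0.
have := fmin (inner h f / q).
rewrite -(@ler_pXn2r _ 2)// ?nnegrE//.
rewrite -[X in _ <= X]inner_norm !(innerBl, innerZl, innerBr, innerZr).
rewrite scalar_conjM scalar_conjV -innerC -/q.
have -> : scalar_conj q = q by rewrite /q -innerC.
rewrite divfK ?gt_eqF// subrr mulr0 subr0 inner_norm lerBrDr.
rewrite gerDl mulrAC (innerC f) mul_scalar_conj.
rewrite pmulr_lle0 ?invr_gt0// => le0.
by apply/eqP; rewrite -normr_eq0 -sqrf_eq0 eq_le le0 exprn_ge0.
Qed.

(** With d the infimum of the norm on C, two points of C of norm below d + e
    have their midpoint of norm at least d, so the parallelogram law bounds the
    square of their distance by 4 (d + e)^2 - 4 d^2.  The traces on C of the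
    balls of radius d + e therefore generate a Cauchy filter, and its limit has
    norm d. *)
Lemma min_norm_point (C : set H) : closed C -> C !=set0 ->
  (forall f g, C f -> C g -> C (2^-1 *: (f + g))) ->
  exists2 z, C z & forall f, C f -> `|z| <= `|f|.
Proof.
move=> Ccl C0 Cmid; pose m (f : H) : R := modulus `|f|.
have mE f : `|f| = of_real k (m f) by rewrite /m -modulusE normr_id.
have m0 f : 0 <= m f by exact: modulus_ge0.
pose d := inf (m @` C).
have d_inf : has_inf (m @` C).
  split; first by case: C0 => f Cf; exists (m f), f.
  by exists 0 => _ [f _ <-].
have d0 : 0 <= d by apply: lb_le_inf => [|_ [f _ <-]//]; exact: d_inf.1.
have d_le f : C f -> d <= m f.
  by move=> Cf; apply: ge_inf; [exact: d_inf.2|exists f].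
have m_close f g e : C f -> C g -> m f < d + e -> m g < d + e ->
    m (f - g) ^+ 2 <= 4 * (d + e) ^+ 2 - 4 * d ^+ 2.
  move=> Cf Cg fe ge.
  have P : m (f + g) ^+ 2 + m (f - g) ^+ 2 = 2 * (m f ^+ 2 + m g ^+ 2).
    apply: (@of_real_inj R k).
    have := parallelogram f g.
    rewrite !mE !expr2 !mulr_natl !mulr2n.
    by rewrite !(of_realM, of_realD).
  have : 2 * d <= m (f + g).
    have := d_le _ (Cmid _ _ Cf Cg).
    have -> : m (2^-1 *: (f + g)) = 2^-1 * m (f + g).
      apply: (@of_real_inj R k); rewrite of_realM -!mE normrZ; congr (_ * _).
      by rewrite ger0_norm ?invr_ge0// of_real_half.
    by rewrite ler_pdivlMl.
  by have := m0 f; have := m0 g; nra.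
pose F : set_system H := filter_from [set e : R | 0 < e]
  (fun e => C `&` [set f | m f < d + e]).
have FF : ProperFilter F.
  apply: filter_from_proper; last first.
    move=> e /= e0; have [_ [f Cf <-] fe] := inf_adherent e0 d_inf.
    by exists f.
  apply: filter_from_filter; first by exists 1; exact: ltr01.
  move=> a b /= a0 b0; exists (Num.min a b); first by rewrite lt_min a0.
  move=> f [Cf /=]; rewrite -ltrBlDl lt_min !ltrBlDl => /andP[fa fb].
  by split.
have FC e : 0 < e -> F (C `&` [set f | m f < d + e]) by move=> e0; exists e.
have /cauchy_cvg/cvg_ex[/= z Fz] : cauchy F.
  apply/cauchy_ballP => E /gt0_of_real[e e0 ->].
  pose c := Num.min 1 (e ^+ 2 / (8 * d + 5)).
  have D0 : 0 < 8 * d + 5 by lra.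
  have c0 : 0 < c by rewrite lt_min ltr01 divr_gt0// exprn_gt0.
  have c1 : c <= 1 by rewrite ge_min lexx.
  have cd : c * (8 * d + 5) <= e ^+ 2 by rewrite -ler_pdivlMr// ge_min lexx orbT.
  (* 4 (d + c)^2 - 4 d^2 = 4 c (2 d + c) <= c (8 d + 4) < e^2, as c <= 1. *)
  exists (C `&` [set f | m f < d + c], C `&` [set f | m f < d + c]).
    by split; exact: FC.
  move=> [f g] /= [[Cf fc] [Cg gc]]; rewrite -ball_normE/= mE ltr_of_real.
  rewrite -(@ltr_pXn2r _ 2)// ?nnegrE ?m0 ?ltW//.
  by have := m_close _ _ _ Cf Cg fc gc; nra.
have mz : m z <= d.
  apply/ler_addgt0Pl => e e0.
  have e2 : 0 < e / 2 by rewrite divr_gt0.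
  have e2K : 0 < of_real k (e / 2).
    by rewrite -of_real0 ltr_of_real.
  have Fze : F [set f | `|z - f| < of_real k (e / 2)].
    by apply: Fz; have := @nbhsx_ballx _ _ z _ e2K; rewrite -ball_normE.
  have [f [/= zf [_ fe]]] := filter_ex (filterI Fze (FC _ e2)).
  have : m z <= m (z - f) + m f.
    by rewrite -(@ler_of_real R k) of_realD -!mE -{1}(subrK f z) ler_normD.
  by move: zf; rewrite mE ltr_of_real /= in fe *; lra.
exists z; last by move=> f /d_le df; rewrite !mE ler_of_real (le_trans mz).
have FC1 : F C by apply: filterS (FC _ ltr01) => f [].
exact: (@closed_cvg _ _ F _ id C Ccl FC1 z Fz).
Qed.


(** The representing vector is z / <z | z>, for z the point of minimal norm on
    the hyperplane phi = 1. *)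
Lemma riesz_representation (phi : {linear H -> (scalars R k)^o}) :
  continuous phi -> exists v, forall f, phi f = inner v f.
Proof.
move=> phic; have [phi0|] := pselect (forall f, phi f = 0).
  exists 0 => f.
  by rewrite phi0 -(scale0r (0 : H)) innerZl scalar_conj0 mul0r.
move=> /existsNP[f0 /eqP f00].
pose C := [set f | phi f = 1].
have Ccl : closed C.
  apply: (@closed_comp _ _ phi [set 1]) => [f _|]; first exact: phic.
  exact: (accessible_closed_set1 (hausdorff_accessible (@norm_hausdorff _ _))).
have [|f g Cf Cg|z Cz zmin] := min_norm_point Ccl.
- by exists ((phi f0)^-1 *: f0); rewrite /C/= linearZ/= /GRing.scale/= mulVf.
- rewrite /C/= linearZ linearD/= Cf Cg /GRing.scale/=.
  by rewrite -[1 + 1]/(2) mulVf.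
(* t h is in ker phi, so the line through z along h stays in C. *)
have z_orth h : phi h = 0 -> inner h z = 0.
  move=> h0; apply: min_norm_orthogonal => t; apply: zmin.
  by rewrite /C/= linearB linearZ/= h0 Cz scaler0 subr0.
have z0 : inner z z != 0.
  rewrite inner_norm sqrf_eq0 normr_eq0; apply/eqP => ze.
  by move: Cz => /eqP; rewrite /C/= ze linear0 eq_sym oner_eq0.
exists ((inner z z)^-1 *: z) => f.
have /z_orth : phi (f - phi f *: z) = 0.
  by rewrite linearB linearZ/= Cz /GRing.scale/= mulr1 subrr.
move=> /(congr1 (@scalar_conj R k)); rewrite scalar_conj0 -innerC.
rewrite innerBr innerZr innerZl scalar_conjV -innerC => /eqP.
by rewrite subr_eq0 => /eqP ->; rewrite mulrC mulfK.
Qed.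

End inner_theory.

(** * Coordinates in l^2(S) *)

Lemma linear_contraction_continuous (K : numFieldType) (V W : normedModType K)
  (f : {linear V -> W}) : (forall x, `|f x| <= `|x|) -> continuous f.
Proof.
move=> f_le; apply: bounded_linear_continuous.
exists 1; split=> [|M M1]; first exact: ger0_real.
have := @nbhsx_ballx _ _ (0 : V) 1 ltr01; apply: filterS => x.
rewrite -ball_normE/= sub0r normrN => /ltW x1.
by rewrite (le_trans (f_le x))// (le_trans x1)// ltW.
Qed.

Section ell2_theory.
Context (R : realType) (k : scalar_kind) (S : choiceType).
Local Notation K := (scalars R k).
Implicit Types u : ell2 R k S.

Lemma ell2_sqr_norm u : sum_sqr u = (modulus `|u| ^+ 2)%:E.
Proof.
have [a a0 ua] := sqr_summableP (valP u).
rewrite ua; congr (_ ^+ 2)%:E; apply: (@of_real_inj R k).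
by rewrite -modulusE normr_id ell2_normE ua/= sqrtr_sqr ger0_norm.
Qed.

Lemma le_ell2_norm u s : `|u s| <= `|u|.
Proof.
rewrite -(normr_id u) !modulusE ler_of_real.
rewrite -(@ler_pXn2r _ 2)// ?nnegrE ?modulus_ge0//.
by rewrite -lee_fin -ell2_sqr_norm le_sum_sqr.
Qed.

(** The codomain is K^o, the field as a normed module over itself, so that
    coordinates are linear forms. *)
Definition ell2_eval (s : S) (u : ell2 R k S) : K^o := u s.

Lemma ell2_eval_linear s : linear (ell2_eval s).
Proof. by []. Qed.

HB.instance Definition _ s :=
  GRing.isLinear.Build K (ell2 R k S) K^o _ (ell2_eval s) (ell2_eval_linear s).

End ell2_theory.

(** * Tight frames and isometries *)

Section tight_frames.
Context {R : realType} {k : scalar_kind} {H : hilbertType R k} {S : choiceType}.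

(** The isometry is the analysis map of the frame. *)
Lemma tight_frame_isometry (v : S -> H) : tight_frame v 1 ->
  exists V : {linear H -> ell2 R k S}, forall f, `|V f| = `|f|.
Proof.
move=> [_ vE].
have coefE f : sum_sqr (fun s => inner (v s) f) = (modulus `|f| ^+ 2)%:E.
  by rewrite vE mul1e.
have coef_sum f : (fun s => inner (v s) f) \in @sqr_summable R k S.
  by rewrite inE/= coefE ltry.
pose T f := Ell2 (coef_sum f).
have Tlin : linear T.
  move=> a f g; apply/val_inj/funext => s /=.
  by rewrite innerDr innerZr.
pose LT := GRing.isLinear.Build _ _ _ _ T Tlin.
pose V : {linear H -> ell2 R k S} := HB.pack T LT.
exists V => f; rewrite -(normr_id (V f)) -(normr_id f) !modulusE.
congr of_real; apply/eqP; rewrite -(@eqrXn2 _ 2) ?modulus_ge0//; apply/eqP.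
by apply: EFin_inj; rewrite -ell2_sqr_norm -coefE.
Qed.

(** The frame vectors represent the coordinate functionals of V. *)
Lemma isometry_tight_frame (V : {linear H -> ell2 R k S}) :
  (forall f, `|V f| = `|f|) -> exists v : S -> H, tight_frame v 1.
Proof.
move=> Viso.
have /choice[v vE] s : exists w, forall f, V f s = inner w f.
  pose phi : {linear H -> (scalars R k)^o} := ell2_eval s \o V.
  apply: (riesz_representation (phi := phi)).
  apply: linear_contraction_continuous => f.
  by rewrite -Viso; exact: le_ell2_norm.
exists v; split=> // f; rewrite mul1e -Viso -ell2_sqr_norm.
by congr sum_sqr; apply/funext => s; exact: vE.
Qed.

End tight_frames.

Theorem theorem2p4 (R : realType) (k : scalar_kind) (S : countType)
    (H : hilbertType R k) :
  (exists v : S -> H, tight_frame v 1) <->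
  (exists V : {linear H -> ell2 R k S}, forall f : H, `|V f| = `|f|).
Proof.
split=> [[v]|[V]]; first exact: tight_frame_isometry.
exact: isometry_tight_frame.
Qed.
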